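(* Let $G$ be a finite connected graph and $P_r$ the path on $r$ vertices. If $r\geq {\rm diam}(G)\,|V(G)|$, then ${\rm ip}_{p}(P_r\,\square\, G)={\rm ip}_{c}(P_r\,\square\, G)=|V(G)|$.
   Context: $P_r\,\square\, G$ is the Cartesian product and ${\rm diam}(G)$ the diameter of $G$. A path is isometric if its length equals the distance between its endpoints; single vertices count as paths. ${\rm ip}_{c}(H)$ (resp. ${\rm ip}_{p}(H)$) is the minimum number of isometric paths of $H$ whose vertex sets cover (resp. partition) $V(H)$. *)

(* Defs.v *)
From mathcomp Require Import all_boot.

Set Implicit Arguments.
Unset Strict Implicit.
Unset Printing Implicit Defensive.

Record sgraph := SGraph {
  vertex :> finType;
  adj : rel vertex;
  adj_sym : symmetric adj;
  adj_irrefl : irreflexive adj }.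

Arguments adj {G} : rename.

Definition path_adj (r : nat) : rel 'I_r :=
  fun i j => (i.+1 == j :> nat) || (j.+1 == i :> nat).

Lemma path_adj_sym r : symmetric (@path_adj r).
Proof. by move=> i j; rewrite /path_adj orbC. Qed.

Lemma path_adj_irrefl r : irreflexive (@path_adj r).
Proof. by move=> i; rewrite /path_adj orbb; apply/negbTE; rewrite neq_ltn ltnSn orbT. Qed.

Definition path_graph (r : nat) : sgraph :=
  SGraph (@path_adj_sym r) (@path_adj_irrefl r).

Definition cart_adj (G H : sgraph) : rel (G * H) :=
  fun u v => ((u.1 == v.1) && adj u.2 v.2) || ((u.2 == v.2) && adj u.1 v.1).

Lemma cart_adj_sym G H : symmetric (@cart_adj G H).
Proof.
by move=> u v; rewrite /cart_adj (eq_sym u.1) (eq_sym u.2) adj_sym (adj_sym u.1).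
Qed.

Lemma cart_adj_irrefl G H : irreflexive (@cart_adj G H).
Proof. by move=> u; rewrite /cart_adj !adj_irrefl !andbF. Qed.

Definition cart_prod (G H : sgraph) : sgraph :=
  SGraph (@cart_adj_sym G H) (@cart_adj_irrefl G H).

(* The graph without vertices is not connected. *)
Definition connected (G : sgraph) : bool :=
  (0 < #|G|) && [forall x : G, forall y : G, connect adj x y].

Definition has_walk (G : sgraph) (x y : G) (n : nat) : bool :=
  [exists p : n.-tuple G, path adj x p && (last x p == y)].

(* The least length (number of edges) of a walk from x to y. Lengths below
   #|G| suffice, since a shortest walk does not repeat vertices; if y cannot be
   reached from x, the value is #|G|. *)
Definition dist (G : sgraph) (x y : G) : nat :=
  find (has_walk x y) (iota 0 #|G|).

Definition diam (G : sgraph) : nat :=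
  \max_(x : G) \max_(y : G) dist x y.

(* A path is given by the nonempty sequence x :: p of its vertices, so its
   length is size p. *)
Definition isometric_path (G : sgraph) (s : seq G) : bool :=
  if s is x :: p then
    [&& path adj x p, uniq s & size p == dist x (last x p)]
  else false.

(* As a path does not repeat vertices, every path of G is a sequence of at most
   #|G| vertices, and these sequences form a finite type. Listing a path in
   both directions gives two sequences; this cannot lower a minimum. *)
Definition isometric_path_cover (G : sgraph) (F : {set #|G|.-bseq G}) : bool :=
  [forall s in F, isometric_path s] && [forall x : G, exists s in F, x \in s].

Definition isometric_path_partition (G : sgraph) (F : {set #|G|.-bseq G}) : bool :=
  isometric_path_cover F &&
  [forall s in F, forall t in F, (s != t) ==> [disjoint s & t]].

Lemma isometric_path1 (G : sgraph) (x : G) : isometric_path [:: x].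
Proof.
rewrite /isometric_path /= /dist (cardD1 x) inE /= ifT //.
by apply/existsP; exists [tuple]; rewrite /= eqxx.
Qed.

Lemma exists_isometric_path_partition (G : sgraph) :
  exists k, [exists F : {set #|G|.-bseq G},
               isometric_path_partition F && (#|F| == k)].
Proof.
have sz1 (x : G) : size [:: x] <= #|G| by rewrite (cardD1 x) inE.
pose F := [set Bseq (sz1 x) | x in G].
exists #|F|; apply/existsP; exists F; rewrite eqxx andbT.
apply/andP; split; first (apply/andP; split).
- by apply/forall_inP => _ /imsetP[x _ ->]; exact: isometric_path1.
- apply/forallP => x; apply/exists_inP; exists (Bseq (sz1 x)).
    exact: imset_f.
  by rewrite /= inE.
apply/forall_inP => _ /imsetP[x _ ->]; apply/forall_inP => _ /imsetP[y _ ->].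
apply/implyP => nexy; apply/pred0P => z /=; apply/negbTE/negP => /andP[].
rewrite !inE => /eqP zx /eqP zy; case/negP: nexy.
by apply/eqP/val_inj; rewrite /= -zx -zy.
Qed.

Lemma exists_isometric_path_cover (G : sgraph) :
  exists k, [exists F : {set #|G|.-bseq G},
               isometric_path_cover F && (#|F| == k)].
Proof.
have [k /existsP[F /andP[/andP[covF _] cardF]]] := exists_isometric_path_partition G.
by exists k; apply/existsP; exists F; rewrite covF.
Qed.

Definition ip_cover (G : sgraph) : nat := ex_minn (exists_isometric_path_cover G).

Definition ip_partition (G : sgraph) : nat :=
  ex_minn (exists_isometric_path_partition G).

(* Main.v *)
(** In [P_r □ G] the [|V(G)|] fibres [P_r × {v}] are isometric paths that
    partition the vertex set. Conversely an isometric path of [P_r □ G] has at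
    most [r + diam G] vertices, so [k] of them cover the [r |V(G)|] vertices
    only if [r |V(G)| <= k (r + diam G)]; for [k < |V(G)|] this would give
    [r <= (|V(G)| - 1) diam G], which is excluded since
    [r >= diam G |V(G)|] and [r > 0]. *)
Require Import Defs.
From mathcomp Require Import all_boot zify.

Set Implicit Arguments.
Unset Strict Implicit.
Unset Printing Implicit Defensive.

Lemma dist_le_walk (G : sgraph) (x : G) (p : seq G) :
  path adj x p -> dist x (last x p) <= size p.
Proof.
move=> xp; rewrite /dist leqNgt; apply/negP => lt_p.
(* [find] never exceeds the length of the searched list, so [dist] is at most [#|G|] and a walk
   shorter than [dist] has a length that was tested. *)
have lt_pG : size p < #|G|.
  by apply: leq_trans lt_p _; rewrite -[X in _ <= X](size_iota 0) find_size.
have /= := before_find 0 lt_p.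
rewrite nth_iota // add0n => /existsP; apply.
by exists (in_tuple p); rewrite /= xp eqxx.
Qed.

(** The strict bound rules out the default value [#|G|], so the search defining [dist] has
    succeeded. *)
Lemma lt_dist_walk (G : sgraph) (x y : G) :
  dist x y < #|G| ->
  exists p, [/\ path adj x p, last x p = y & size p = dist x y].
Proof.
move=> ltG; have hw : has (has_walk x y) (iota 0 #|G|).
  by rewrite has_find size_iota.
have := nth_find 0 hw; rewrite nth_iota // add0n => /existsP[p /andP[xp /eqP py]].
by exists p; rewrite size_tuple.
Qed.

(** Removing repetitions leaves a walk with at most [#|G|] vertices, hence with fewer than [#|G|]
    edges. *)
Lemma connect_dist_lt (G : sgraph) (x y : G) :
  connect adj x y -> dist x y < #|G|.
Proof.
case/connectP => p /shortenP[q xq uq _] ->.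
apply: leq_ltn_trans (dist_le_walk xq) _.
by have /card_uniqP sz := uq; rewrite -[_.+1]/(size (x :: q)) -sz max_card.
Qed.

Lemma dist_le_diam (G : sgraph) (x y : G) : dist x y <= diam G.
Proof.
apply: leq_trans (leq_bigmax (F := fun z : G => \max_(t : G) dist z t) x).
exact: (leq_bigmax (F := fun t : G => dist x t) y).
Qed.

Lemma dist_cart_prod_le (G H : sgraph) (x1 y1 : G) (x2 y2 : H) :
  connect adj x1 y1 -> connect adj x2 y2 ->
  dist (G := cart_prod G H) (x1, x2) (y1, y2) <= dist x1 y1 + dist x2 y2.
Proof.
move=> /connect_dist_lt/lt_dist_walk[p [xp <- <-]].
move=> /connect_dist_lt/lt_dist_walk[q [xq <- <-]].
(* Move along a shortest walk in the first factor, then along one in the second. *)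
pose w := [seq (z, x2) | z <- p] ++ [seq (last x1 p, z) | z <- q].
have lastp : last (x1, x2) [seq (z, x2) | z <- p] = (last x1 p, x2).
  by rewrite (last_map (pair^~ x2)).
have xw : path (adj (G := cart_prod G H)) (x1, x2) w.
  rewrite cat_path lastp (path_map (f := pair^~ x2)) path_map.
  apply/andP; split.
    by apply: sub_path xp => a b /=; rewrite /cart_adj /= eqxx => ->; rewrite orbT.
  by apply: sub_path xq => a b /=; rewrite /cart_adj /= eqxx => ->.
have := dist_le_walk xw.
by rewrite last_cat lastp last_map size_cat !size_map.
Qed.

Lemma path_graph_connect r (i j : path_graph r) : connect adj i j.
Proof.
have conS (a : 'I_r) (m : nat) (lt_m : m < r) :
    a <= m -> connect (adj (G := path_graph r)) a (Ordinal lt_m).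
  elim: m lt_m => [|m IHm] lt_m.
    by rewrite leqn0 => /eqP a0; rewrite (_ : a = Ordinal lt_m) //; apply: val_inj.
  rewrite leq_eqVlt => /predU1P[a_m | lt_am].
    by rewrite (_ : a = Ordinal lt_m) //; apply: val_inj.
  apply: connect_trans (IHm (ltnW lt_m) lt_am) (connect1 _).
  by rewrite /= /path_adj /= eqxx.
have con (a b : 'I_r) : a <= b -> connect (adj (G := path_graph r)) a b.
  by case: b => b lt_b /conS.
case/orP: (leq_total i j) => /con // ji.
by rewrite (sym_connect_sym (@adj_sym (path_graph r))).
Qed.

Lemma isometric_path_size_le (G : sgraph) r (s : seq (cart_prod (path_graph r) G)) :
  connected G -> isometric_path s -> size s <= r + diam G.
Proof.
case/andP => _ /forallP conG; case: s => // -[i x] p /and3P[_ _ /eqP /=].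
case: (last _ p) => j y ->.
have con_xy : connect adj x y by apply: (forallP (conG x)).
have con_ij := path_graph_connect (i : path_graph r) j.
(* A path has one vertex more than its length; strictness of [dist i j < r] absorbs this extra
   vertex. *)
have := connect_dist_lt con_ij; rewrite card_ord => lt_r.
apply: leq_trans (leq_add lt_r (dist_le_diam x y)).
exact: (dist_cart_prod_le con_ij con_xy).
Qed.

(** Each edge raises the first coordinate by at most one. This bounds from below the distance
    between the ends of a fibre. *)
Lemma cart_walk_fst_le (G : sgraph) r (u : cart_prod (path_graph r) G)
    (p : seq (cart_prod (path_graph r) G)) :
  path adj u p -> (last u p).1 <= u.1 + size p.
Proof.
elim: p u => [|v p IHp] u /=; first by rewrite addn0.
case/andP => uv /IHp le_v; apply: leq_trans le_v _.
rewrite addnS -addSn leq_add2r.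
case/orP: uv => /andP[/eqP eq_uv]; first by rewrite eq_uv.
by rewrite /= /path_adj => /orP[] /eqP; lia.
Qed.

Lemma fibre_isometric (G : sgraph) r (v : G) : 0 < r ->
  isometric_path (G := cart_prod (path_graph r) G) [seq (i, v) | i <- enum 'I_r].
Proof.
case: r => // r _.
have srt : sorted (adj (G := cart_prod (path_graph r.+1) G))
    [seq (i, v) | i <- enum 'I_r.+1].
  have : sorted (fun i j => i.+1 == j) (iota 0 r.+1).
    by rewrite /=; elim: r 0 => //= r IHr m; rewrite eqxx IHr.
  rewrite -val_enum_ord sorted_map (sorted_map (f := pair^~ v)).
  apply: sub_sorted => i j /= ij.
  by rewrite /cart_adj /= /path_adj ij eqxx orbT.
have unq : uniq [seq (i, v) | i <- enum 'I_r.+1].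
  by rewrite map_inj_uniq ?enum_uniq // => i j [].
have lst : last (ord0, v) [seq (i, v) | i <- enum 'I_r.+1] = (ord_max, v).
  rewrite -(nth_last (ord0, v)) size_map size_enum_ord /=.
  rewrite (nth_map ord0) ?size_enum_ord //; congr (_, _).
  by apply: val_inj; rewrite /= nth_enum_ord.
have sz : size [seq (i, v) | i <- enum 'I_r.+1] = r.+1.
  by rewrite size_map size_enum_ord.
(* Needed so that a distance below [r] is attained by an actual walk. *)
have lt_r : r < #|cart_prod (path_graph r.+1) G|.
  by rewrite card_prod card_ord leq_pmulr //; apply/card_gt0P; exists v.
move: srt unq lst sz; rewrite enum_ordSl /= => srt unq lst [sz].
have := dist_le_walk (G := cart_prod (path_graph r.+1) G) srt; rewrite srt unq lst sz /= eqn_leq => -> /=.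
(* A walk with fewer than [r] edges cannot raise the first coordinate from [0] to [r]. *)
rewrite andbT leqNgt; apply/negP => lt_dist.
have [q [uq lq sq]] := lt_dist_walk (ltn_trans lt_dist lt_r).
have := cart_walk_fst_le uq; rewrite lq sq /= add0n.
by rewrite leqNgt lt_dist.
Qed.

Lemma ip_cover_le_partition (G : sgraph) : ip_cover G <= ip_partition G.
Proof.
rewrite /ip_partition; case: ex_minnP => k /existsP[F /andP[/andP[covF _] cardF]] _.
rewrite /ip_cover; case: ex_minnP => m _; apply.
by apply/existsP; exists F; rewrite covF.
Qed.

Lemma ip_partition_cart_path_le (G : sgraph) r : 0 < r ->
  ip_partition (cart_prod (path_graph r) G) <= #|G|.
Proof.
move=> r_gt0; set K := cart_prod _ _.
pose f v : seq K := [seq (i, v) | i <- enum 'I_r].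
have f_sz v : size (f v) <= #|K|.
  rewrite size_map size_enum_ord card_prod card_ord leq_pmulr //.
  by apply/card_gt0P; exists v.
(* The second coordinate alone decides membership in a fibre, which gives both covering and
   disjointness. *)
have in_f (u : K) v : (u \in f v) = (u.2 == v).
  apply/mapP/eqP => [[i _ ->] // | <-].
  by exists u.1; rewrite ?mem_enum //; case: u.
pose F : {set #|K|.-bseq K} := [set Bseq (f_sz v) | v in G].
have partF : isometric_path_partition F.
  apply/andP; split; first (apply/andP; split).
  - by apply/forall_inP => _ /imsetP[v _ ->]; apply: fibre_isometric.
  - apply/forallP => u; apply/exists_inP; exists (Bseq (f_sz u.2)).
      exact: imset_f.
    by rewrite /= in_f.
  apply/forall_inP => _ /imsetP[v _ ->]; apply/forall_inP => _ /imsetP[w _ ->].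
  apply/implyP => ne_vw; apply/pred0P => u /=; apply/negbTE/negP => /andP[].
  rewrite /= !in_f => /eqP uv /eqP uw; case/negP: ne_vw.
  by apply/eqP/val_inj; rewrite /= -uv -uw.
apply: leq_trans (leq_imset_card (fun v => Bseq (f_sz v)) G).
rewrite /ip_partition; case: ex_minnP => m _; apply.
by apply/existsP; exists F; rewrite partF eqxx.
Qed.

(** Union bound over the vertex sets of the members of [F]. *)
Lemma card_le_cover (G : sgraph) (F : {set #|G|.-bseq G}) (b : nat) :
  isometric_path_cover F -> (forall s, isometric_path s -> @size G s <= b) ->
  #|G| <= #|F| * b.
Proof.
case/andP => /forall_inP isoF /forallP covF le_b.
have sub : G \subset \bigcup_(s in F) [set x in s].
  apply/subsetP => x _; have /exists_inP[s sF xs] := covF x.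
  by apply/bigcupP; exists s; rewrite ?inE.
apply: leq_trans (subset_leq_card sub) _.
apply: (@leq_trans (\sum_(s in F) #|[set x in s]|)).
  elim/big_rec2: _ => [|s m A _ le_m]; first by rewrite cards0.
  by apply: leq_trans (leq_card_setU _ _) _; rewrite leq_add2l.
rewrite -sum_nat_const; apply: leq_sum => s /isoF/le_b.
by apply: leq_trans; rewrite cardsE card_size.
Qed.

Lemma ip_cover_cart_path_ge (G : sgraph) r :
  connected G -> 0 < r -> diam G * #|G| <= r ->
  #|G| <= ip_cover (cart_prod (path_graph r) G).
Proof.
move=> conG r_gt0 r_ge; rewrite /ip_cover.
case: ex_minnP => k /existsP[F /andP[covF /eqP <-]] _.
have := card_le_cover covF (fun s iso_s => isometric_path_size_le conG iso_s).
(* If [c < n], then [r * n <= c * (r + d)] gives [r <= (n - 1) * d]. For [d > 0] the right side is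
   below [n * d <= r]; for [d = 0] it contradicts [0 < r]. *)
move: #|F| => c; rewrite card_prod card_ord; move: #|G| (diam G) r_ge => n d; nia.
Qed.

Theorem theorem5 (G : sgraph) (r : nat) (conG : connected G)
    (r_gt0 : 0 < r) (r_ge : diam G * #|G| <= r) :
  ip_partition (cart_prod (path_graph r) G) = ip_cover (cart_prod (path_graph r) G) /\
  ip_cover (cart_prod (path_graph r) G) = #|G|.
Proof.
have le_cp := ip_cover_le_partition (cart_prod (path_graph r) G).
have le_pn := ip_partition_cart_path_le G r_gt0.
have le_nc := ip_cover_cart_path_ge conG r_gt0 r_ge.
lia.
Qed.
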